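(* For every positive integer $k$, $g_{k}(K_3,GR_k(K_3))=1$ if $k$ is odd, and $g_{k}(K_3,GR_k(K_3))=2$ if $k$ is even.
   Context: A Gallai-$k$-coloring is an edge-coloring of a complete graph with colors from $[k]$ containing no rainbow triangle (triangle with three distinct colors). $GR_k(K_3)$ is the minimum integer $N$ such that every Gallai-$k$-coloring of $K_N$ contains a monochromatic triangle. $g_k(K_3,n)$ is the minimum number of monochromatic triangles taken over all Gallai-$k$-colorings of $K_n$. *)

(* Defs.v *)
From mathcomp Require Import all_boot.

Set Implicit Arguments.
Unset Strict Implicit.
Unset Printing Implicit Defensive.

Section Colorings.
Variables (T : finType) (k : nat).

(* The edges of the complete graph on T; [k] is rendered as 'I_k. *)
Definition edge := {e : {set T} | #|e| == 2}.
Definition coloring := {ffun edge -> 'I_k}.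

Implicit Types (c : coloring) (t : {set T}).

Definition is_triangle t := #|t| == 3.

Definition colors_on c t : {set 'I_k} := [set c e | e : edge & val e \subset t].

Definition rainbow_triangle c t := is_triangle t && (#|colors_on c t| == 3).
Definition mono_triangle c t := is_triangle t && (#|colors_on c t| == 1).

Definition gallai c := [forall t, ~~ rainbow_triangle c t].

Definition num_mono c := #|[set t | mono_triangle c t]|.

Lemma num_mono_le c : num_mono c <= 'C(#|T|, 3).
Proof.
rewrite -card_draws; apply: subset_leq_card; apply/subsetP=> t.
by rewrite !inE => /andP[].
Qed.

End Colorings.

Definition forces_mono (k N : nat) : bool :=
  [forall c : coloring 'I_N k, gallai c ==> [exists t, mono_triangle c t]].

Section Existence.
Variables (T : finType) (k : nat) (c : coloring T k).

Fixpoint ramsey_bound (j : nat) : nat :=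
  if j is i.+1 then i.+1 * ramsey_bound i + 2 else 2.

Lemma edge_in (A : {set T}) : 1 < #|A| -> exists e : edge T, val e \subset A.
Proof.
case/card_gt1P=> x [y [xA yA xy]].
have xyE : #|[set x; y]| == 2 by rewrite cards2 xy.
exists (Sub [set x; y] xyE); rewrite SubK.
by apply/subsetP=> u; rewrite !inE => /orP[] /eqP ->.
Qed.

Lemma mono_of_color (a : 'I_k) (t : {set T}) :
    is_triangle t -> (forall e : edge T, val e \subset t -> c e = a) ->
  mono_triangle c t.
Proof.
move=> t3 ta; rewrite /mono_triangle t3 /=; apply/cards1P; exists a.
apply/setP=> b; rewrite inE; apply/imsetP/eqP => [[e]|->].
  by rewrite inE => /ta -> ->.
have [|e et] := @edge_in t; first by rewrite (eqP t3).
by exists e; rewrite ?inE ?ta.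
Qed.

Lemma ramsey_mono j (S : {set 'I_k}) (A : {set T}) :
    #|S| = j -> ramsey_bound j <= #|A| ->
    (forall e : edge T, val e \subset A -> c e \in S) ->
  exists t, mono_triangle c t.
Proof.
elim: j S A => [|j IHj] S A cS cA AS.
  have [e /AS] := edge_in cA.
  by move/eqP: cS; rewrite cards_eq0 => /eqP ->; rewrite inE.
have [v vA] : exists v, v \in A.
  by apply/set0Pn; rewrite -card_gt0; apply: leq_trans cA; rewrite /= addn2.
pose B a := [set u in A :\ v | [exists e : edge T,
  (val e == [set v; u]) && (c e == a)]].
have sub : A :\ v \subset \bigcup_(a in S) B a.
  apply/subsetP=> u; rewrite !inE => /andP[uv uA].
  have vuE : #|[set v; u]| == 2 by rewrite cards2 (eq_sym v) uv.
  pose e : edge T := Sub [set v; u] vuE.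
  apply/bigcupP; exists (c e).
    by apply: AS; rewrite SubK subUset !sub1set vA.
  by rewrite !inE uv uA; apply/existsP; exists e; rewrite SubK !eqxx.
have [a aS cB] : exists2 a, a \in S & ramsey_bound j <= #|B a|.
  apply/exists_inP; apply: contraT; rewrite negb_exists_in => /forall_inP BS.
  have le1 : #|A :\ v| <= j.+1 * ramsey_bound j.
    apply: leq_trans (subset_leq_card sub) _.
    apply: (@leq_trans (\sum_(a in S) #|B a|)).
      elim/big_rec2: _ => [|a m A' _ le_m]; first by rewrite cards0.
      by apply: leq_trans (leq_card_setU _ _) _; rewrite leq_add2l.
    rewrite -cS -sum_nat_const; apply: leq_sum => a /BS.
    by rewrite -ltnNge => /ltnW.
  move: cA; rewrite (cardsD1 v) vA /= addn2 add1n ltnS => /leq_trans /(_ le1).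
  by rewrite ltnn.
have [/existsP[e /andP[eB /eqP ea]]|noa] :=
    boolP [exists e : edge T, (val e \subset B a) && (c e == a)].
  have vNe : v \notin val e.
    by apply/negP=> /(subsetP eB); rewrite !inE eqxx.
  exists (v |: val e); apply: (@mono_of_color a).
    by rewrite /is_triangle cardsU1 vNe (eqP (valP e)).
  move=> e' e't; have [ve'|vNe'] := boolP (v \in val e'); last first.
    suff -> : e' = e by [].
    apply/val_inj/eqP; rewrite eqEcard (eqP (valP e)) (eqP (valP e')) leqnn.
    rewrite andbT; apply/subsetP=> x xe'; have := subsetP e't x xe'.
    by rewrite in_setU1 => /orP[/eqP xv|//]; rewrite -xv xe' in vNe'.
  have [u eu] : exists u, val e' :\ v = [set u].
    apply/cards1P; have := valP e'.
    by rewrite /= (cardsD1 v) ve' add1n eqSS.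
  have : u \in val e' :\ v by rewrite eu set11.
  rewrite !inE => /andP[uv ue']; have := subsetP e't u ue'.
  rewrite in_setU1 (negPf uv) /= => /(subsetP eB).
  rewrite inE => /andP[_ /existsP[e'' /andP[/eqP ve'' /eqP <-]]].
  congr (c _); apply: val_inj; rewrite ve'' -eu.
  by apply/setP=> x; rewrite !inE; case: eqP => // ->.
apply: (IHj (S :\ a) (B a)) => //.
  by move/eqP: cS; rewrite (cardsD1 a) aS add1n eqSS => /eqP.
move=> e eB; rewrite in_setD1 AS ?andbT; last first.
  by apply: subset_trans eB _; apply/subsetP=> x; rewrite !inE => /andP[/andP[_ ->]].
by apply: contraNneq noa => ea; apply/existsP; exists e; rewrite eB ea eqxx.
Qed.
End Existence.

Lemma forces_mono_ex k : exists N, forces_mono k N.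
Proof.
exists (ramsey_bound k); apply/forallP=> c; apply/implyP=> _; apply/existsP.
apply: (@ramsey_mono _ _ c k setT setT); rewrite ?cardsT ?card_ord //.
by move=> e _; rewrite in_setT.
Qed.

(* GR_k(K_3); existence of such an N is a crude Ramsey argument. *)
Definition gallai_ramsey3 (k : nat) : nat := ex_minn (forces_mono_ex k).

(* g_k(K_3, n).  The initial value 'C(n, 3) does not affect the minimum when
   0 < k, since it is an upper bound on [num_mono] and Gallai colorings exist
   (see [min_mono_attained]). *)
Definition min_mono (k n : nat) : nat :=
  \big[minn/'C(n, 3)]_(c : coloring 'I_n k | gallai c) num_mono c.

Lemma min_mono_le k n (c : coloring 'I_n k) :
  gallai c -> min_mono k n <= num_mono c.
Proof.
move=> gc; rewrite /min_mono; have := mem_index_enum c.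
elim: (index_enum _) => // d s IHs; rewrite inE big_cons.
case/predU1P=> [<-|/IHs le_s]; first by rewrite gc geq_minl.
by case: ifP => // _; rewrite geq_min le_s orbT.
Qed.

Lemma min_mono_attained k n : 0 < k ->
  exists2 c : coloring 'I_n k, gallai c & num_mono c = min_mono k n.
Proof.
move=> k_gt0; pose c0 : coloring 'I_n k := [ffun=> Ordinal k_gt0].
have c0t t : #|colors_on c0 t| <= 1.
  rewrite -(cards1 (Ordinal k_gt0)); apply/subset_leq_card/subsetP=> b.
  by case/imsetP=> e _ ->; rewrite ffunE set11.
have gc0 : gallai c0.
  apply/forallP=> t; rewrite negb_and; apply/orP; right.
  by rewrite neq_ltn (leq_ltn_trans (c0t t)).
have [c gc cmin] := arg_minnP (@num_mono _ _) gc0.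
exists c => //; apply/eqP; rewrite eqn_leq min_mono_le // andbT.
apply: (big_ind (fun m => num_mono c <= m)) => // [|m1 m2].
  by have := num_mono_le c; rewrite card_ord.
by rewrite leq_min => -> ->.
Qed.

(* Main.v *)
(** A Gallai colouring with at least three colours has a disconnected colour
    class; contracting its components and iterating yields a partition whose
    parts are joined by at most two colours, each pair of parts by a single
    one. If some part sees only one colour outside, the vertex set splits in two
    halves joined by one colour; otherwise every part sees both colours and, as
    six vertices carry two monochromatic triangles in two colours, there are at
    most five parts. Without monochromatic triangles the joining colours do not
    occur inside the parts, and induction bounds the order by 5^(k/2) for even
    k and 2 * 5^((k-1)/2) for odd k. For even k the bound leaves enough room to
    allow one monochromatic triangle. Iterated blow-ups of the two-coloured K_5,
    around a one-coloured K_2 when k is odd, are extremal; a further vertex,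
    made a twin in an innermost copy, creates one triangle for odd k and two
    for even k. *)

Require Import Defs.
From mathcomp Require Import all_boot.
From mathcomp Require Import zify.

Set Implicit Arguments.
Unset Strict Implicit.
Unset Printing Implicit Defensive.

(** * Gallai partitions *)

Section GallaiColoring.
Variables (T K : finType) (c : T -> T -> K).
Hypothesis csym : forall x y, c x y = c y x.
Hypothesis cgal :
  forall x y z, [|| c x y == c y z, c y z == c x z | c x y == c x z].

Implicit Types (A X Y t : {set T}) (R S : {set K}) (i j : K).

Definition used_colors A : {set K} :=
  [set i | [exists x in A, exists y in A, (x != y) && (c x y == i)]].

Lemma used_colorsP A i :
  reflect (exists x y, [/\ x \in A, y \in A, x != y & c x y = i])
          (i \in used_colors A).
Proof.
rewrite inE; apply: (iffP exists_inP) => [[x xA /exists_inP[y yA]]|[x [y [xA yA xy cxy]]]].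
  by case/andP=> xy /eqP cxy; exists x, y.
by exists x => //; apply/exists_inP; exists y; rewrite // xy cxy eqxx.
Qed.

Definition color_rel A i : rel T := fun x y => [&& x \in A, y \in A & c x y == i].
Arguments color_rel A i x y /.

Lemma color_connect_sym A i : connect_sym (color_rel A i).
Proof. by apply: sym_connect_sym => x y; rewrite /= csym andbCA. Qed.

Lemma connect_color_in A i x y :
  connect (color_rel A i) x y -> x \in A -> y \in A.
Proof.
move=> xy xA; suff cl : closed (color_rel A i) (mem A) by rewrite -(closed_connect cl xy).
by apply: (intro_closed (@color_connect_sym A i)) => u v /= /and3P[].
Qed.

(* If uw has colour i and uy, wy do not, then uy and wy agree: propagate this
   along a path of colour i. *)
Lemma component_color A i x x' y :
    y \in A -> connect (color_rel A i) x x' ->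
    ~~ connect (color_rel A i) x y ->
  c x y = c x' y.
Proof.
move=> yA xx' xNy.
pose a := [pred z | connect (color_rel A i) x z && (c z y == c x y)].
suff cl : closed (color_rel A i) a.
  have := closed_connect cl xx'; rewrite !inE connect0 eqxx /=.
  by case/esym/andP=> _ /eqP.
apply: (intro_closed (@color_connect_sym A i)) => u w uw.
rewrite !inE => /andP[xu /eqP <-].
have xw := connect_trans xu (connect1 uw); rewrite xw /=.
have /and3P[uA wA /eqP cuw] := uw.
have Ni z : z \in A -> connect (color_rel A i) x z -> c z y != i.
  move=> zA xz; apply: contra xNy => czy; apply: connect_trans xz _.
  by apply: connect1; rewrite /= zA yA.
have := cgal u w y; rewrite cuw (eq_sym i) (negPf (Ni w wA xw)).
by rewrite (eq_sym i) (negPf (Ni u uA xu)) orbF.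
Qed.

(** Otherwise [X] would be closed under edges of colour [i], so [v] could not be reached from
    [u]. *)
Lemma connected_crossing A X i u v :
    (forall x y, x \in A -> y \in A -> connect (color_rel A i) x y) ->
    X \subset A -> u \in X -> v \in A -> v \notin X ->
  exists x y, [/\ x \in X, y \in A, y \notin X & c x y = i].
Proof.
move=> conn XA uX vA vNX.
have [/exists_inP[x xX /exists_inP[y yA /andP[yX /eqP cxy]]]|noc] := boolP
    [exists x in X, exists y in A, (y \notin X) && (c x y == i)].
  by exists x, y.
suff cl : closed (color_rel A i) (mem X).
  have := closed_connect cl (conn u v (subsetP XA u uX) vA).
  by rewrite /= uX (negPf vNX).
apply: (intro_closed (@color_connect_sym A i)) => x y /= /and3P[xA yA cxy] xX.
apply: contraR noc => yX; apply/exists_inP; exists x => //.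
by apply/exists_inP; exists y; rewrite // yX.
Qed.

Lemma disconnected_color A : 2 < #|used_colors A| ->
  exists2 i, i \in used_colors A &
    exists x y, [/\ x \in A, y \in A & ~~ connect (color_rel A i) x y].
Proof.
have [n] := ubnP #|A|; elim: n A => // n IHn A ltAn A3.
have [/exists_inP[i iA /exists_inP[x xA /exists_inP[y yA xy]]]|noc] := boolP
    [exists i in used_colors A, exists x in A, exists y in A,
       ~~ connect (color_rel A i) x y].
  by exists i => //; exists x, y.
have {noc}conn i x y : i \in used_colors A -> x \in A -> y \in A ->
    connect (color_rel A i) x y.
  move=> iA xA yA; apply: contraR noc => xy; apply/exists_inP; exists i => //.
  by apply/exists_inP; exists x => //; apply/exists_inP; exists y.
exfalso.
have [v vA] : exists v, v \in A.
  have /card_gt0P[i /used_colorsP[x [y [xA _ _ _]]]] : 0 < #|used_colors A|.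
    by apply: leq_trans A3.
  by exists x.
(* Every used colour connects [A], hence leaves [[set v]]. *)
have star i : i \in used_colors A -> exists y, [/\ y \in A, y != v & c v y = i].
  move=> iA; have [u [uA uv]] : exists u, u \in A /\ u \notin [set v].
    have /used_colorsP[x [y [xA yA xy _]]] := iA.
    have [yv|] := eqVneq y v; last by exists y; rewrite inE.
    by exists x; rewrite inE -yv.
  have [|x [y []]] := connected_crossing (fun x y => @conn i x y iA) _ (set11 v) uA uv.
    by rewrite sub1set.
  by rewrite !inE => /eqP-> yA yv cvy; exists y.
have ltA' : #|A :\ v| < n by move: ltAn; rewrite (cardsD1 v) vA.
have [A'2|/(IHn _ ltA')[i iA' [x0 [y0 [x0A y0A Nxy0]]]]] := leqP #|used_colors (A :\ v)| 2.
  (* A colour [i] lost with [v] lives only on edges at [v]. To reach every vertex it must colour all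
     of them, against a second colour [j] at [v]. *)
  have /subsetPn[i iA iNA'] : ~~ (used_colors A \subset used_colors (A :\ v)).
    by apply/negP=> /subset_leq_card /(leq_trans A3); rewrite ltnNge A'2.
  have [j] : exists j, j \in used_colors A :\ i.
    by apply/card_gt0P; move: A3; rewrite (cardsD1 i) iA add1n ltnS; case: #|_|.
  rewrite !inE => /andP[ji jA].
  have [u [uA uv cvu]] : exists y, [/\ y \in A, y != v & c v y = j] by apply: star; rewrite inE.
  have vNu : v \notin [set u] by rewrite inE eq_sym.
  have [|x [y []]] := connected_crossing (fun x y => @conn i x y iA) _ (set11 u) vA vNu.
    by rewrite sub1set.
  rewrite !inE => /eqP-> yA yu cuy; case: (eqVneq y v) => [yv|yv].
    by move: ji; rewrite -cvu -cuy yv csym eqxx.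
  case/negP: iNA'; apply/used_colorsP; exists u, y.
  by rewrite !inE uv yv uA yA eq_sym yu.
have iA : i \in used_colors A.
  have /used_colorsP[x [y [xA yA xy cxy]]] := iA'; apply/used_colorsP; exists x, y.
  by move: xA yA; rewrite !inE => /andP[_ ->] /andP[_ ->].
pose e := color_rel (A :\ v) i.
(* The component [Z] of [z] must reach [v] by an edge [xv] of colour [i]; the triangle [vxy] then
   gives [xy] the colour [j], and [component_color] carries it over to [zy]. *)
have outer j y z : c v y = j -> j != i -> y \in A :\ v -> z \in A :\ v ->
    ~~ connect e y z -> c y z = j.
  move=> cvy ji yA' zA' Nyz; pose Z := [set x | connect e z x].
  have ZA' : Z \subset A :\ v.
    by apply/subsetP=> x; rewrite inE => zx; apply: connect_color_in zx zA'.
  have ZA : Z \subset A := subset_trans ZA' (subD1set _ _).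
  have zZ : z \in Z by rewrite inE connect0.
  have vZ : v \notin Z by apply/negP=> /(subsetP ZA'); rewrite !inE eqxx.
  have [x [w [xZ wA wZ cxw]]] := connected_crossing (fun x y => @conn i x y iA) ZA zZ vA vZ.
  have xA' := subsetP ZA' x xZ.
  have wv : w = v.
    apply/eqP; apply: contraR wZ => wv; rewrite !inE in xZ *.
    by apply: connect_trans xZ (connect1 _); rewrite /e /= xA' !inE wv wA cxw /=.
  rewrite {w wA wZ}wv in cxw.
  have cxy : c x y != i.
    apply: contra Nyz => cxy; rewrite /e color_connect_sym; rewrite inE in xZ.
    by apply: connect_trans xZ (connect1 _); rewrite /e /= xA' yA'.
  rewrite csym (@component_color (A :\ v) i z x y) //; last 2 first.
  - by rewrite inE in xZ.
  - by rewrite color_connect_sym.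
  have := cgal v x y; rewrite (csym v x) cxw cvy ![i == _]eq_sym.
  by rewrite (negPf cxy) (negPf ji) orbF => /eqP.
(* Two colours [j], [l] other than [i] lead from [v] to [y] and [z]. By [outer] they clash on [yz]
   if [y] and [z] lie in different components, and otherwise on the edges to a vertex [w] of another
   component. *)
have [j [l [jA lA jl]]] : exists j l, [/\ j \in used_colors A :\ i,
    l \in used_colors A :\ i & j != l].
  apply/card_gt1P; by move: A3; rewrite (cardsD1 i) iA.
have{jA} [ji /star[y [yA yv cvy]]] := setD1P jA.
have{lA} [li /star[z [zA zv cvz]]] := setD1P lA.
have yA' : y \in A :\ v by rewrite !inE yv.
have zA' : z \in A :\ v by rewrite !inE zv.
have [yz|Nyz] := boolP (connect e y z); last first.
  case/eqP: jl; rewrite -(outer j y z) // csym; apply: outer => //.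
  by rewrite /e color_connect_sym.
have [w wA' Nyw] : exists2 w, w \in A :\ v & ~~ connect e y w.
  have [yx0|?] := boolP (connect e y x0); last by exists x0.
  exists y0 => //; apply: contra Nxy0 => yy0.
  by rewrite color_connect_sym in yx0; apply: connect_trans yx0 yy0.
case/eqP: jl; rewrite -(outer j y w) // -(outer l z w) //.
  exact: (@component_color (A :\ v) i).
by apply: contra Nyw; apply: connect_trans.
Qed.

(* [p] chooses a representative in each part of a Gallai partition of [A]. *)
Definition gallai_map A (p : T -> T) R :=
  [/\ #|R| <= 2,
      forall x, x \in A -> p x \in A,
      forall x, x \in A -> p (p x) = p x &
      forall x y, x \in A -> y \in A -> p x != p y ->
        c x y = c (p x) (p y) /\ c x y \in R].

(** With more than two colours, the components of a disconnected colour are contracted to their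
    roots, which are partitioned by induction; [component_color] makes two components see each other
    in one colour. *)
Lemma gallai_partition A : 1 < #|A| ->
  exists p R, gallai_map A p R /\ exists x y, [/\ x \in A, y \in A & p x != p y].
Proof.
have [n] := ubnP #|A|; elim: n A => // n IHn A ltAn A2.
have [le2|gt2] := leqP #|used_colors A| 2.
  exists id, (used_colors A); split; last by case/card_gt1P: A2 => x [y []]; exists x, y.
  split=> // x y xA yA xy; split=> //; apply/used_colorsP; by exists x, y.
have [i iA [x0 [y0 [x0A y0A xy0]]]] := disconnected_color gt2.
pose e := color_rel A i; have sy := @color_connect_sym A i.
pose X := [set root e x | x in A].
have rA x : x \in A -> root e x \in A.
  by apply: connect_color_in (connect_root e x).
have XA : X \subset A by apply/subsetP=> _ /imsetP[x xA ->]; apply: rA.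
have rX x : x \in X -> root e x = x by case/imsetP=> y _ ->; apply: root_root.
have cr x y : x \in A -> y \in A -> root e x != root e y -> c x y = c (root e x) (root e y).
  move=> xA yA rxy; have Nxy : ~~ connect e x y by rewrite -(root_connect sy).
  rewrite (component_color yA (connect_root e x) Nxy) csym.
  rewrite (component_color (rA x xA) (connect_root e y)) 1?csym //.
  by rewrite -(root_connect sy) eq_sym (root_root sy).
(* An edge of colour [i] has both ends in one component, so some vertex is not a root. *)
have ltX : #|X| < n.
  rewrite -ltnS; apply: leq_ltn_trans ltAn; apply: proper_card.
  rewrite properE XA; apply/negP=> AX.
  have /used_colorsP[x [y [xA yA xy cxy]]] := iA; case/eqP: xy.
  rewrite -[x]rX ?(subsetP AX) // -[y]rX ?(subsetP AX) //.
  by apply/(rootP sy)/connect1; rewrite /e /= xA yA cxy /=.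
have X2 : 1 < #|X|.
  apply/card_gt1P; exists (root e x0), (root e y0); rewrite !imset_f //.
  by split=> //; rewrite (root_connect sy).
have [p [R [[R2 pX pp pc] [x [y [xX yX pxy]]]]]] := IHn X ltX X2.
exists (p \o root e), R; split; last first.
  by exists x, y; rewrite /= !rX // !(subsetP XA).
split=> // [u uA|u uA|u v uA vA puv] /=.
- by apply: (subsetP XA); apply: pX; apply: imset_f.
- by rewrite (rX (p _)) ?pp ?pX ?imset_f.
have ruv : root e u != root e v by apply: contraNneq puv => /= ->.
by rewrite cr //; apply: pc; rewrite ?imset_f.
Qed.

Lemma gallai_dichotomy A : 1 < #|A| ->
  (exists X Y i, [/\ A = X :|: Y, [disjoint X & Y], X != set0, Y != set0 &
     forall x y, x \in X -> y \in Y -> c x y = i]) \/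
  (exists p R, [/\ gallai_map A p R, #|R| = 2 & forall x i, x \in A -> i \in R ->
     exists y, [/\ y \in A, p y != p x & c (p x) (p y) = i]]).
Proof.
move=> A2; have [p [R [pR [x0 [y0 [x0A y0A pxy0]]]]]] := gallai_partition A2.
have [Rle2 pA pp pc] := pR.
(* The colours leaving the part of [x]; if there is at most one, this part is split off as one
   half. *)
pose N x := [set c (p x) (p y) | y in A & p y != p x].
have NR x : x \in A -> N x \subset R.
  move=> xA; apply/subsetP=> j /imsetP[y]; rewrite inE => /andP[yA pyx] ->.
  by rewrite eq_sym in pyx; have [<-] := pc x y xA yA pyx.
have [/exists_inP[x xA le1]|noc] := boolP [exists x in A, #|N x| <= 1]; last first.
  right; exists p, R.
  have NE x : x \in A -> N x = R /\ #|R| = 2.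
    move=> xA; have lt1 : 1 < #|N x|.
      by rewrite ltnNge; apply: contra noc => ?; apply/exists_inP; exists x.
    have /eqP NxR : N x == R by rewrite eqEcard NR ?(leq_trans Rle2).
    by split=> //; apply/eqP; rewrite eqn_leq Rle2 -NxR.
  split=> //; first by case: (NE x0 x0A).
  move=> x i xA; have [<- _] := NE x xA; case/imsetP=> y; rewrite inE => /andP[yA pyx] ->.
  by exists y.
left; have [y yA pyx] : exists2 y, y \in A & p y != p x.
  have [xx0|] := eqVneq (p x0) (p x); last by exists x0.
  by exists y0; rewrite // -xx0 eq_sym.
exists [set z in A | p z == p x], [set z in A | p z != p x], (c (p x) (p y)); split.
- by apply/setP=> z; rewrite !inE -andb_orr orbN andbT.
- by rewrite -setI_eq0; apply/eqP/setP=> z; rewrite !inE; case: (p z == _); rewrite ?andbF.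
- by apply/set0Pn; exists x; rewrite !inE xA /=.
- by apply/set0Pn; exists y; rewrite !inE yA.
move=> u v; rewrite !inE => /andP[uA /eqP pu] /andP[vA pv].
have [->] : c u v = c (p x) (p v) /\ c u v \in R by rewrite -pu; apply: pc; rewrite // pu eq_sym.
by move=> _; apply: (card_le1_eqP le1); apply: imset_f; rewrite inE ?vA ?yA.
Qed.

(** * Upper bounds on the order *)

Definition mono x y z :=
  [&& x != y, y != z, z != x, c x y == c y z & c y z == c z x].

Lemma mono_rot x y z : mono x y z -> mono y z x.
Proof.
by case/and5P=> xy yz zx /eqP e1 /eqP e2; rewrite /mono xy yz zx -e2 -e1 !eqxx.
Qed.

Lemma mono_eq i x y z : x != y -> y != z -> z != x ->
  c x y = i -> c y z = i -> c z x = i -> mono x y z.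
Proof. by rewrite /mono => -> -> -> -> -> -> /=; rewrite !eqxx. Qed.

(** [t = set0] expresses that [A] has no monochromatic triangle, [#|t| <= 3] that it has at most
    one. Testing the first vertex suffices, since triangles can be rotated. *)
Definition mono_within A t := forall x y z,
  x \in A -> y \in A -> z \in A -> mono x y z -> x \in t.

Lemma mono_within3 A t x y z : mono_within A t ->
  x \in A -> y \in A -> z \in A -> mono x y z -> [/\ x \in t, y \in t & z \in t].
Proof.
move=> At xA yA zA m; have m' := mono_rot m; have m'' := mono_rot m'.
by split; [apply: (At x y z)|apply: (At y z x)|apply: (At z x y)].
Qed.

Lemma mono_withinS A A' t : A' \subset A -> mono_within A t -> mono_within A' t.
Proof. by move=> /subsetP sA At x y z xA yA zA; apply: At; apply: sA. Qed.

Lemma mono_vertices A t x y z : mono_within A t -> #|t| <= 3 ->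
  x \in A -> y \in A -> z \in A -> mono x y z -> t = [set x; y; z].
Proof.
move=> At t3 xA yA zA m; have [xt yt zt] := mono_within3 At xA yA zA m.
have /and5P[xy yz zx _ _] := m.
apply/esym/eqP; rewrite eqEcard !subUset !sub1set xt yt zt /=.
by rewrite -setUA cardsU1 cards2 !inE negb_or xy yz eq_sym zx.
Qed.

Lemma mono_within_del A t w :
  mono_within A t -> #|t| <= 3 -> w \in t -> mono_within (A :\ w) set0.
Proof.
move=> At t3 wt x y z; rewrite !inE => /andP[xw xA] /andP[yw yA] /andP[zw zA] m.
move: wt; rewrite (mono_vertices At t3 xA yA zA m) !inE ![w == _]eq_sym.
by rewrite (negPf xw) (negPf yw) (negPf zw).
Qed.

Lemma two_colors_eq R i a b : #|R| <= 2 -> i \in R -> a \in R -> b \in R ->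
  a != i -> b != i -> a = b.
Proof.
move=> R2 iR aR bR ai bi; have le1 : #|R :\ i| <= 1 by move: R2; rewrite (cardsD1 i) iR.
by apply: (card_le1_eqP le1); rewrite !inE ?ai ?bi.
Qed.

Definition colored_by A R := forall x y, x \in A -> y \in A -> x != y -> c x y \in R.

Lemma colored_byS A A' R : A' \subset A -> colored_by A R -> colored_by A' R.
Proof. by move=> /subsetP sA AR x y xA yA; apply: AR; apply: sA. Qed.

(** Every vertex outside [t] is joined to all of [t] in the colour missing inside [t]. The vertices
    outside [t], at least three if [A] has six, then avoid that colour among themselves and span a
    second triangle. *)
Lemma two_color_bound A R t : #|R| <= 2 -> #|t| <= 3 ->
  colored_by A R -> mono_within A t -> #|A| <= 5.
Proof.
move=> R2 t3 AR At; rewrite leqNgt; apply/negP=> A6.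
(* Three neighbours of [v] along one colour [j] span the triangle [t]. *)
have star v : v \in A :\: t -> exists j, [/\ #|t| = 3, t \subset A :\ v, j \in R
    & {in t, forall w, c v w = j /\ {in t, forall w', w != w' -> c w w' != j}}].
  case/setDP=> vA vNt.
  have [W [WA W3 [j Wj]]] : exists W : {set T}, [/\ W \subset A :\ v, 2 < #|W|
      & exists j, {in W, forall w, c v w = j}].
    have Av5 : 4 < #|A :\ v| by move: A6; rewrite (cardsD1 v) vA.
    have [y yA] : exists y, y \in A :\ v by apply/card_gt0P; apply: leq_trans Av5.
    pose W := [set w | c v w == c v y].
    have [gt2|le2] := ltnP 2 #|(A :\ v) :&: W|.
      exists ((A :\ v) :&: W); split=> //; first exact: subsetIl.
      by exists (c v y) => w; rewrite inE => /andP[_]; rewrite inE => /eqP.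
    exists ((A :\ v) :\: W); split; first exact: subsetDl.
      by move: Av5; rewrite -(cardsID W (A :\ v)); lia.
    have vc w : w \in A :\ v -> c v w \in R.
      by rewrite !inE => /andP[wv wA]; apply: AR; rewrite // eq_sym.
    have [->|/set0Pn[z]] := eqVneq ((A :\ v) :\: W) set0.
      by exists (c v y) => w; rewrite inE.
    case/setDP=> zA zW; exists (c v z) => w /setDP[wA wW].
    rewrite !inE in zW wW.
    by apply: (two_colors_eq R2 (vc y yA)); rewrite ?vc.
  have Wne w : w \in W -> w \in A /\ w != v.
    by move/(subsetP WA); rewrite !inE => /andP[].
  have jR : j \in R.
    have /card_gt0P[w wW] : 0 < #|W| by apply: leq_trans W3.
    by have [wA wv] := Wne w wW; rewrite -(Wj w wW); apply: AR; rewrite // eq_sym.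
  have Wc w w' : w \in W -> w' \in W -> w != w' -> c w w' != j.
    move=> wW w'W ww'; apply: contra vNt => /eqP cww'.
    have [[wA wv] [w'A w'v]] := (Wne w wW, Wne w' w'W).
    apply: (At v w w') => //; apply: (@mono_eq j) => //; first by rewrite eq_sym.
      exact: Wj.
    by rewrite csym Wj.
  have Wt : W \subset t.
    apply/subsetP=> w wW.
    have /card_gt1P[x [y [xW yW xy]]] : 1 < #|W :\ w| by move: W3; rewrite (cardsD1 w) wW.
    move: xW yW; rewrite !inE => /andP[xw xW] /andP[yw yW].
    have [[wA _] [xA _] [yA _]] := And3 (Wne w wW) (Wne x xW) (Wne y yW).
    have eqc u u' : u \in W -> u' \in W -> u != u' -> c u u' = c w x.
      move=> uW u'W uu'; apply: (two_colors_eq R2 jR); rewrite ?Wc // 1?eq_sym //.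
        by have [uA _] := Wne u uW; have [u'A _] := Wne u' u'W; apply: AR.
      by apply: AR; rewrite // eq_sym.
    apply: (At w x y) => //.
    apply: (@mono_eq (c w x)) => //; try exact: eqc; by rewrite eq_sym.
  have /eqP tW : W == t by rewrite eqEcard Wt (leq_trans t3).
  exists j; rewrite -tW; split=> //.
    by apply/eqP; rewrite eqn_leq W3 andbT tW.
  by move=> w wW; split=> [|w' w'W]; [apply: Wj | apply: Wc].
have [v vAt] : exists v, v \in A :\: t.
  apply/card_gt0P; move: (cardsID t A) (subset_leq_card (subsetIr A t)); lia.
have [j [t3' tA jR tj]] := star v vAt.
have /card_gt1P[x [y [xt yt xy]]] : 1 < #|t| by rewrite t3'.
have [cvx /(_ y yt xy) cxy] := tj x xt.
have xA : x \in A by have := subsetP tA x xt; rewrite !inE => /andP[].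
have yA : y \in A by have := subsetP tA y yt; rewrite !inE => /andP[].
(* The edge [xy] of [t] avoids the colour from [u] as well as [j], and there are only two
   colours. *)
have same u : u \in A :\: t -> c u x = j.
  move=> ut; have [i [_ _ iR ti]] := star u ut.
  have [-> /(_ y yt xy) cxy'] := ti x xt.
  by apply: (two_colors_eq R2 (AR x y xA yA xy)); rewrite // eq_sym.
have cNt u u' : u \in A :\: t -> u' \in A :\: t -> u != u' -> c u u' != j.
  move=> ut u't uu'; have [/setDP[uA uNt] /setDP[u'A u'Nt]] := (ut, u't).
  apply: contra uNt => /eqP cuu'; apply: (At u u' x) => //.
  apply: (@mono_eq j) => //.
  - by apply: contraNneq u'Nt => ->.
  - by apply: contraTneq xt => ->; have /setDP[] := ut.
  - exact: same.
  - by rewrite csym same.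
have /card_gt2P[u [v' [w [[ut v't wt] [uv vw wu]]]]] : 2 < #|A :\: t|.
  by move: (cardsID t A) (subset_leq_card (subsetIr A t)); lia.
have [[uA uNt] [v'A _] [wA _]] := And3 (setDP ut) (setDP v't) (setDP wt).
case/negP: uNt; apply: (At u v' w) => //.
have eqc a b : a \in A :\: t -> b \in A :\: t -> a != b -> c a b = c u v'.
  move=> at_ bt ab; have [[aA _] [bA _]] := (setDP at_, setDP bt).
  by apply: (two_colors_eq R2 jR); rewrite ?cNt // AR.
by apply: (@mono_eq (c u v')) => //; apply: eqc.
Qed.

Definition extremal k := 2 ^ odd k * 5 ^ k./2.

Lemma extremal_gt0 k : 0 < extremal k.
Proof. by rewrite muln_gt0 !expn_gt0. Qed.

Lemma extremal_add2 k : extremal k.+2 = 5 * extremal k.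
Proof. by rewrite /extremal /= negbK expnS mulnCA. Qed.

(** Equality for even [k]. For odd [k] the gap between 4 and 5 times a power of 5 leaves room for
    the spare vertex needed in [one_triangle_join]. *)
Lemma extremal_double k : 2 * extremal k + odd k <= extremal k.+1.
Proof.
rewrite /extremal /= uphalf_half; have := expn_gt0 5 k./2.
by case: (odd k); rewrite /= ?add1n ?add0n ?expnS; lia.
Qed.

Lemma extremal_even_ge5 k : ~~ odd k -> 0 < k -> 5 <= extremal k.
Proof.
case: k => [|[|k]] // _ _; rewrite extremal_add2.
by have := extremal_gt0 k; lia.
Qed.

(** An edge of colour [i] in [X] would close a monochromatic triangle with [y]. *)
Lemma neighbor_colored A X S y i : mono_within A set0 -> colored_by A S ->
    X \subset A -> y \in A -> y \notin X -> (forall x, x \in X -> c x y = i) ->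
  colored_by X (S :\ i).
Proof.
move=> Afree AS /subsetP XA yA yX Xy u v uX vX uv.
rewrite !inE AS ?XA // andbT; apply/negP=> /eqP cuv.
suff : u \in set0 by rewrite inE.
apply: (Afree u v y); [exact: XA|exact: XA|by []|apply: (@mono_eq i) => //].
- by apply: contraNneq yX => <-.
- by apply: contraNneq yX => ->.
- exact: Xy.
- by rewrite csym Xy.
Qed.

Lemma join_colored X Y S i :
    mono_within (X :|: Y) set0 -> colored_by (X :|: Y) S ->
    [disjoint X & Y] -> X != set0 -> Y != set0 ->
    (forall x y, x \in X -> y \in Y -> c x y = i) ->
  [/\ i \in S, colored_by X (S :\ i) & colored_by Y (S :\ i)].
Proof.
move=> free colS dXY /set0Pn[x xX] /set0Pn[y yY] XYi.
have xA : x \in X :|: Y by rewrite inE xX.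
have yA : y \in X :|: Y by rewrite inE yY orbT.
have yNX : y \notin X by rewrite (disjointFl dXY).
have xNY : x \notin Y by rewrite (disjointFr dXY).
split.
- by rewrite -(XYi x y xX yY); apply: colS => //; apply: contraNneq yNX => <-.
- apply: (neighbor_colored free colS (subsetUl X Y) yA yNX) => u uX; exact: XYi.
- apply: (neighbor_colored free colS (subsetUr X Y) xA xNY) => u uY.
  by rewrite csym; apply: XYi.
Qed.

Definition fiber A (p : T -> T) q := [set x in A | p x == q].

Lemma card_fibers A p : #|A| = \sum_(q in p @: A) #|fiber A p q|.
Proof.
rewrite -sum1_card (partition_big_imset p); apply: eq_bigr => q _.
by rewrite sum1dep_card; apply: eq_card => x; rewrite !inE.
Qed.

Lemma gallai_map_card A p R t : gallai_map A p R ->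
  mono_within A t -> #|t| <= 3 -> #|p @: A| <= 5.
Proof.
case=> R2 pA pp pc At t3; have sA : p @: A \subset A.
  by apply/subsetP=> _ /imsetP[x xA ->]; apply: pA.
apply: (two_color_bound R2 t3) (mono_withinS sA At).
move=> _ _ /imsetP[x xA ->] /imsetP[y yA ->] pxy.
by case: (pc (p x) (p y)); rewrite ?pA ?pp.
Qed.

(** The parts of [x] and [y] are joined by a single colour, here that of [xx']. *)
Lemma monochromatic_fiber_edge A p R x x' y : gallai_map A p R ->
    x \in A -> x' \in A -> y \in A -> x != x' -> p x = p x' -> p y != p x ->
    c (p x) (p y) = c x x' ->
  mono x x' y.
Proof.
case=> _ _ _ pc xA x'A yA xx' pxx' pyx cxy.
have [cxy' _] : c x y = c (p x) (p y) /\ c x y \in R by apply: pc; rewrite // eq_sym.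
have [cx'y _] : c x' y = c (p x') (p y) /\ c x' y \in R.
  by apply: pc; rewrite // -pxx' eq_sym.
apply: (@mono_eq (c x x')) => //.
- by apply: contraNneq pyx => <-; rewrite pxx'.
- by apply: contraNneq pyx => ->.
- by rewrite cx'y -pxx'.
- by rewrite csym cxy'.
Qed.

Lemma gallai_colors_subset A p R S : gallai_map A p R ->
    (forall x i, x \in A -> i \in R ->
       exists y, [/\ y \in A, p y != p x & c (p x) (p y) = i]) ->
  A != set0 -> colored_by A S -> R \subset S.
Proof.
case=> _ pA _ _ pR /set0Pn[x xA] AS; apply/subsetP=> i iR.
have [y [yA pyx <-]] := pR x i xA iR.
by apply: AS; rewrite ?pA // eq_sym.
Qed.

(** Either two halves each lose their joining colour, or at most five parts each lose both colours
    of [R]; [extremal_double] and [extremal_add2] match these cases. *)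
Lemma free_bound A S :
  mono_within A set0 -> colored_by A S -> #|A| <= extremal #|S|.
Proof.
have [n] := ubnP #|S|; elim: n A S => // n IHn A S ltSn Afree AS.
have [le1|A2] := leqP #|A| 1; first exact: leq_trans le1 (extremal_gt0 _).
have A0 : A != set0 by rewrite -card_gt0 ltnW.
have [[X [Y [i [AXY dXY X0 Y0 XYi]]]]|] := gallai_dichotomy A2.
  rewrite {}AXY in Afree AS *.
  have [iS XS YS] := join_colored Afree AS dXY X0 Y0 XYi.
  have cS : #|S| = #|S :\ i|.+1 by rewrite (cardsD1 i) iS.
  have lt : #|S :\ i| < n by rewrite -ltnS -cS.
  have leX := IHn _ _ lt (mono_withinS (subsetUl X Y) Afree) XS.
  have leY := IHn _ _ lt (mono_withinS (subsetUr X Y) Afree) YS.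
  rewrite cS; apply: leq_trans (leq_trans (leq_addr _ _) (extremal_double _)).
  by apply: leq_trans (leq_card_setU X Y) _; rewrite mul2n -addnn leq_add.
case=> p [R [pR R2 pRy]].
have RS := gallai_colors_subset pR pRy A0 AS.
have cS : #|S| = #|S :\: R|.+2 by rewrite -(cardsID R S) (setIidPr RS) R2.
rewrite cS extremal_add2 (card_fibers A p).
have := gallai_map_card pR Afree; rewrite cards0 => /(_ isT) p5.
apply: leq_trans (_ : #|p @: A| * extremal #|S :\: R| <= _); last by rewrite leq_mul2r p5 orbT.
rewrite -sum_nat_const; apply: leq_sum => q _.
have sub : fiber A p q \subset A by apply/subsetP=> x; rewrite inE => /andP[].
apply: IHn; first by rewrite -ltnS (leq_trans _ ltSn) // cS.
  exact: mono_withinS sub Afree.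
move=> u v; rewrite !inE => /andP[uA /eqP pu] /andP[vA /eqP pv] uv.
rewrite AS // andbT; apply/negP=> cuvR.
(* Every part sees both colours of [R] outside, so an inner edge in one of them closes a
   triangle. *)
have [y [yA pyu cuy]] := pRy u _ uA cuvR.
suff : u \in set0 by rewrite inE.
apply: (Afree u v y) => //.
by apply: (monochromatic_fiber_edge pR) => //; rewrite pu.
Qed.

(** Deleting a vertex [w] of [t] leaves no triangle, so both halves lose colour [i] and have an odd
    number of colours left; the surplus in [extremal_double] pays for [w]. *)
Lemma one_triangle_join X Y S t i :
    ~~ odd #|S| -> #|t| <= 3 -> t \subset X :|: Y -> 1 < #|t| ->
    mono_within (X :|: Y) t -> colored_by (X :|: Y) S ->
    [disjoint X & Y] -> X != set0 -> 1 < #|Y| ->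
    (forall x y, x \in X -> y \in Y -> c x y = i) ->
  #|X :|: Y| <= extremal #|S|.
Proof.
move=> evS t3 tA t2 At AS dXY X0 Y2 XYi.
(* [X] must survive the deletion: [w] is taken outside [X] if possible; otherwise [t] lies in [X]
   and another vertex of [t] remains. *)
have [w wt Xw] : exists2 w, w \in t & X :\ w != set0.
  have [tX|/subsetPn[w wt wX]] := boolP (t \subset X); last first.
    by exists w; rewrite // (setDidPl _) // disjoint_sym disjoints1.
  have /card_gt1P[w [w' [wt w't ww']]] := t2.
  by exists w => //; apply/set0Pn; exists w'; rewrite !inE eq_sym ww' (subsetP tX).
have Yw : Y :\ w != set0.
  by rewrite -card_gt0; move: Y2; rewrite (cardsD1 w); case: (w \in Y); case: #|_|.
have EA : (X :|: Y) :\ w = (X :\ w) :|: (Y :\ w) by rewrite setDUl.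
have free := mono_within_del At t3 wt.
have AwS := colored_byS (subD1set _ w) AS.
rewrite EA in free AwS.
have dXYw : [disjoint X :\ w & Y :\ w].
  by apply: disjointWl (subD1set X w) (disjointWr (subD1set Y w) dXY).
have [|iS XS YS] := join_colored free AwS dXYw Xw Yw (i := i).
  by move=> a b; rewrite !inE => /andP[_ aX] /andP[_ bY]; apply: XYi.
have leX := free_bound (mono_withinS (subsetUl _ _) free) XS.
have leY := free_bound (mono_withinS (subsetUr _ _) free) YS.
have cS : #|S| = #|S :\ i|.+1 by rewrite (cardsD1 i) iS.
have odSi : odd #|S :\ i| by move: evS; rewrite cS /= negbK.
have := extremal_double #|S :\ i|; rewrite -cS odSi.
have := leq_of_leqif (leq_card_setU (X :\ w) (Y :\ w)); rewrite -EA.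
rewrite (cardsD1 w (X :|: Y)) (subsetP tA w wt) /=; lia.
Qed.

Lemma one_triangle_bound A S t : ~~ odd #|S| -> #|t| <= 3 ->
  mono_within A t -> colored_by A S -> #|A| <= extremal #|S|.
Proof.
have [n] := ubnP #|S|; elim: n A S => // n IHn A S ltSn evS t3 At AS.
have [/existsP[x /existsP[y /existsP[z /and4P[xA yA zA xyz]]]]|noT] := boolP
    [exists x, exists y, exists z, [&& x \in A, y \in A, z \in A & mono x y z]]; last first.
  apply: free_bound => // x y z xA yA zA m; case/negP: noT.
  by apply/existsP; exists x; apply/existsP; exists y; apply/existsP; exists z; apply/and4P.
have tE := mono_vertices At t3 xA yA zA xyz.
(* Settling at most two colours first makes [S :\: R] nonempty below. *)
have [S2|S2] := leqP #|S| 2.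
  have [S0|S_gt0] := posnP #|S|.
    have /and5P[xy _ _ _ _] := xyz; have := AS x y xA yA xy.
    by rewrite (cards0_eq S0) inE.
  by apply: leq_trans (two_color_bound S2 t3 AS At) (extremal_even_ge5 evS S_gt0).
have free w : w \in t -> mono_within (A :\ w) set0 := mono_within_del At t3.
have tA : t \subset A by rewrite tE !subUset !sub1set xA yA zA.
have t2 : 1 < #|t|.
  by apply/card_gt1P; exists x, y; have /and5P[] := xyz; rewrite tE !inE !eqxx orbT.
have A2 : 1 < #|A| := leq_trans t2 (subset_leq_card tA).
have A0 : A != set0 by rewrite -card_gt0 ltnW.
have [[X [Y [i [AXY dXY X0 Y0 XYi]]]]|] := gallai_dichotomy A2.
  rewrite AXY in At AS tA *.
  have [Y2|Y1] := ltnP 1 #|Y|; first exact: (one_triangle_join evS t3 tA t2 At AS dXY X0 Y2 XYi).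
  have [X2|X1] := ltnP 1 #|X|.
    rewrite disjoint_sym in dXY; rewrite setUC in At AS tA *.
    apply: (one_triangle_join evS t3 tA t2 At AS dXY Y0 X2) => a b aY bX.
    by rewrite csym; apply: XYi.
  have := leq_of_leqif (leq_card_setU X Y); have := extremal_even_ge5 evS; lia.
case=> p [R [pR R2 pRy]].
have RS := gallai_colors_subset pR pRy A0 AS.
have cS : #|S| = #|S :\: R|.+2 by rewrite -(cardsID R S) (setIidPr RS) R2.
have evSR : ~~ odd #|S :\: R| by move: evS; rewrite cS /= negbK.
have ltSR : #|S :\: R| < n by rewrite -ltnS (leq_trans _ ltSn) // cS.
have p5 := gallai_map_card pR At t3.
have fA q : fiber A p q \subset A by apply/subsetP=> u; rewrite inE => /andP[].
rewrite cS extremal_add2.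
(* If no part has an inner edge in a colour of [R], the parts have two colours fewer and the
   induction hypothesis applies to each with the same [t]. *)
have [/existsP[u /existsP[v /and5P[uA vA uv /eqP puv cuv]]]|noR] := boolP
    [exists u, exists v, [&& u \in A, v \in A, u != v, p u == p v & c u v \in R]]; last first.
  rewrite (card_fibers A p).
  apply: leq_trans (_ : #|p @: A| * extremal #|S :\: R| <= _); last by rewrite leq_mul2r p5 orbT.
  rewrite -sum_nat_const; apply: leq_sum => q _.
  apply: IHn => //; first exact: mono_withinS (fA q) At.
  move=> u v; rewrite !inE => /andP[uA /eqP pu] /andP[vA /eqP pv] uv.
  rewrite AS // andbT; apply: contra noR => cuv.
  by apply/existsP; exists u; apply/existsP; exists v; rewrite uA vA uv pu pv eqxx.
(* The triangle consists of an edge uv inside a part and a vertex w outside;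
   then {w} is a part, and no part of A \ {u} has an inner edge of a colour in R. *)
have [w [wA pwu cuw]] := pRy u _ uA cuv.
have uvw := monochromatic_fiber_edge pR uA vA wA uv puv pwu cuw.
have tE' := mono_vertices At t3 uA vA wA uvw.
have Aufree : mono_within (A :\ u) set0 by apply: free; rewrite tE' !inE eqxx.
have fiber_w : #|fiber (A :\ u) p (p w)| <= 1.
  rewrite -(cards1 w); apply: subset_leq_card; apply/subsetP=> w'.
  rewrite !inE => /andP[/andP[_ w'A] /eqP pw'].
  have m : mono u v w'.
    by apply: (monochromatic_fiber_edge pR) => //; rewrite pw'.
  have [_ _] := mono_within3 At uA vA w'A m.
  rewrite tE' !inE -orbA => /or3P[|/eqP w'v|] //.
    by move=> /eqP w'u; move: pwu; rewrite -pw' w'u eqxx.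
  by move: pwu; rewrite -pw' w'v puv eqxx.
have fiber_le q : #|fiber (A :\ u) p q| <= extremal #|S :\: R|.
  have sub : fiber (A :\ u) p q \subset A :\ u by apply/subsetP=> a; rewrite inE => /andP[].
  apply: free_bound (mono_withinS sub Aufree) _.
  move=> a b; rewrite !inE => /andP[/andP[au aA] /eqP pa] /andP[/andP[bu bA] /eqP pb] ab.
  rewrite AS // andbT; apply/negP=> cab.
  have [d [dA pda cad]] := pRy a _ aA cab.
  have m : mono a b d by apply: (monochromatic_fiber_edge pR) => //; rewrite pa.
  have [at_ bt dt] := mono_within3 At aA bA dA m.
  (* The triangle [abd] is [t], so [d = u] and [a], [b] are [v], [w] in some order; but [v] and [w]
     lie in different parts. *)
  have : u \in t by rewrite tE' !inE eqxx.
  rewrite (mono_vertices At t3 aA bA dA m) !inE ![u == _]eq_sym (negPf au) (negPf bu) /=.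
  move=> /eqP du; move: at_ bt ab; rewrite tE' !inE (negPf au) (negPf bu) /=.
  case/orP=> /eqP ea; case/orP=> /eqP eb; rewrite ea eb ?eqxx //.
    by move: pwu; rewrite puv -ea -eb pa pb eqxx.
  by move: pwu; rewrite puv -ea -eb pa pb eqxx.
have wAu : w \in A :\ u by rewrite !inE wA andbT; apply: contraNneq pwu => ->.
have sub5 : #|p @: (A :\ u)| <= 5.
  by apply: leq_trans p5; apply/subset_leq_card/imsetS/subD1set.
(* The part of [w] counts 1 and at most four others count [e = extremal #|S :\: R|] each; restoring
   [u] gives [2 + 4 * e <= 5 * e], since [e >= 5]. *)
have : #|A :\ u| <= 1 + 4 * extremal #|S :\: R|.
  rewrite (card_fibers _ p) (bigD1 (p w)) /=; last exact: imset_f.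
  apply: leq_add fiber_w _.
  apply: leq_trans (_ : \sum_(q in (p @: (A :\ u)) :\ p w) extremal #|S :\: R| <= _).
    rewrite [X in _ <= X](eq_bigl (fun q => (q \in p @: (A :\ u)) && (q != p w))).
      by apply: leq_sum.
    by move=> q; rewrite !inE andbC.
  rewrite sum_nat_const leq_mul2r; apply/orP; right.
  by move: sub5; rewrite (cardsD1 (p w)) imset_f.
have SR_gt0 : 0 < #|S :\: R| by rewrite cS in S2.
rewrite (cardsD1 u A) uA; move: (extremal_even_ge5 evSR SR_gt0).
by move: (extremal _) #|_ :\ u| => e a; clear; lia.
Qed.

End GallaiColoring.

(** * Extremal colourings *)

(* On residues modulo 5, [chord] is the complement of the 5-cycle; both graphs
   are triangle-free. *)
Definition chord x y := (x + 2 == y %[mod 5]) || (y + 2 == x %[mod 5]).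

Lemma chordC x y : chord x y = chord y x.
Proof. by rewrite /chord orbC. Qed.

Lemma chord_mod x y : chord (x %% 5) (y %% 5) = chord x y.
Proof. by rewrite /chord !modnDml !modn_mod. Qed.

Lemma chord_mono x y z : chord x y = chord y z -> chord y z = chord z x ->
  [|| x == y %[mod 5], y == z %[mod 5] | z == x %[mod 5]].
Proof.
rewrite -(chord_mod x y) -(chord_mod y z) -(chord_mod z x).
move: (x %% 5) (y %% 5) (z %% 5) (ltn_pmod x (isT : 0 < 5))
  (ltn_pmod y (isT : 0 < 5)) (ltn_pmod z (isT : 0 < 5)).
by do 3 case=> [|[|[|[|[|?]]]]] //.
Qed.

(* The lowest base-5 digit in which [x] and [y] differ decides the colour; when
   the [m] lowest digits agree, the quotients by 5 ^ m are coloured by one colour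
   if [b] and by [chord] otherwise. Then [core b] quotients span no monochromatic
   triangle; the quotient [core b] itself belongs to the additional vertex, which
   for [chord] is a twin of 0. *)
Fixpoint blowup b m x y : nat :=
  if m is m'.+1 then
    if x == y %[mod 5] then blowup b m' (x %/ 5) (y %/ 5)
    else (~~ b).+1 + m'.*2 + chord x y
  else ~~ b && chord x y.

Lemma blowupC b m x y : blowup b m x y = blowup b m y x.
Proof. by elim: m x y => [|m IHm] x y /=; rewrite chordC // eq_sym IHm. Qed.

(** Each digit owns two colours, larger than all those of the deeper levels; the quotients use the
    lowest one or two. *)
Lemma blowup_lt b m x y : blowup b m x y < (~~ b).+1 + m.*2.
Proof.
elim: m x y => [|m IHm] x y /=; first by case: b; case: chord.
by case: ifP => _; [have := IHm (x %/ 5) (y %/ 5)|case: chord]; lia.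
Qed.

(** Three different lowest digits meet only two colours, two equal ones look alike to the third
    vertex, and three equal ones lead to the induction hypothesis. *)
Lemma blowup_gallai b m x y z :
  [|| blowup b m x y == blowup b m y z, blowup b m y z == blowup b m x z
    | blowup b m x y == blowup b m x z].
Proof.
elim: m x y z => [|m IHm] x y z /=.
  by case: b; case: (chord x y); case: (chord y z); case: (chord x z).
case: (eqVneq (x %% 5) (y %% 5)) => [exy|nxy]; last first.
  case: (eqVneq (y %% 5) (z %% 5)) => [eyz|nyz].
    by rewrite -eyz (negPf nxy) -(chord_mod x z) -eyz chord_mod eqxx !orbT.
  case: (eqVneq (x %% 5) (z %% 5)) => [exz|nxz].
    by rewrite -(chord_mod y z) -exz chord_mod chordC eqxx.
  by rewrite !eqn_add2l; case: (chord x y); case: (chord y z); case: (chord x z).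
rewrite exy; case: (eqVneq (y %% 5) (z %% 5)) => [//|nyz].
by rewrite -(chord_mod x z) exy chord_mod eqxx !orbT.
Qed.

(** Different lowest digits give a colour foreign to the deeper levels, so the three lowest digits
    are all equal or all different, and [chord_mono] excludes the latter. The common digits make up
    [r]. *)
Lemma blowup_mono b m x y z :
    blowup b m x y = blowup b m y z -> blowup b m y z = blowup b m z x ->
  exists r u v w, [/\ x = u * 5 ^ m + r, y = v * 5 ^ m + r, z = w * 5 ^ m + r &
    blowup b 0 u v = blowup b 0 v w /\ blowup b 0 v w = blowup b 0 w u].
Proof.
elim: m x y z => [|m IHm] x y z.
  by move=> e1 e2; exists 0, x, y, z; rewrite !muln1 !addn0.
rewrite [blowup b m.+1 x y]/= [blowup b m.+1 y z]/= [blowup b m.+1 z x]/=.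
have := blowup_lt b m (x %/ 5) (y %/ 5); have := blowup_lt b m (y %/ 5) (z %/ 5).
have := blowup_lt b m (z %/ 5) (x %/ 5).
case: (eqVneq (x %% 5) (y %% 5)) => [exy|nxy]; case: (eqVneq (y %% 5) (z %% 5)) => [eyz|nyz];
  case: (eqVneq (z %% 5) (x %% 5)) => [ezx|nzx] l1 l2 l3 e1 e2; try by [exfalso; lia|
  rewrite exy eyz eqxx in nzx|rewrite ezx exy eqxx in nyz|rewrite eyz ezx eqxx in nxy].
  have [r [u [v [w [ex ey ez base]]]]] := IHm _ _ _ e1 e2.
  exists (5 * r + x %% 5), u, v, w.
  split=> //; rewrite expnS.
  - by rewrite {1}(divn_eq x 5) ex; lia.
  - by rewrite {1}(divn_eq y 5) ey exy; lia.
  - by rewrite {1}(divn_eq z 5) ez ezx; lia.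
exfalso; have /or3P[] : [|| x == y %[mod 5], y == z %[mod 5] | z == x %[mod 5]].
- apply: chord_mono.
    by move: e1; case: (chord x y); case: (chord y z); lia.
  by move: e2; case: (chord z x); case: (chord y z); lia.
- by rewrite (negPf nxy).
- by rewrite (negPf nyz).
- by rewrite (negPf nzx).
Qed.

Definition core b := if b then 2 else 5.

(** The twins 0 and 5 are joined in the colour of the 5-cycle, hence form triangles with their
    common neighbours 1 and 4 on it. *)
Definition core_triangles b := if b then [:: [:: 0; 1; 2]] else [:: [:: 0; 1; 5]; [:: 0; 4; 5]].

Lemma core_mono b u v w : u <= core b -> v <= core b -> w <= core b ->
    u != v -> v != w -> w != u ->
    blowup b 0 u v = blowup b 0 v w -> blowup b 0 v w = blowup b 0 w u ->
  core b \in [:: u; v; w] /\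
  exists2 q, q \in core_triangles b & {subset [:: u; v; w] <= q}.
Proof.
move=> ub vb wb uv vw wu e1 e2.
have : (core b \in [:: u; v; w]) &&
    has (fun q => all (mem q) [:: u; v; w]) (core_triangles b).
  case: b ub vb wb e1 e2 => /= ub vb wb.
    by case: u v w ub vb wb uv vw wu => [|[|[|?]]] // [|[|[|?]]] // [|[|[|?]]].
  by case: u v w ub vb wb uv vw wu => [|[|[|[|[|[|?]]]]]] // [|[|[|[|[|[|?]]]]]] //
    [|[|[|[|[|[|?]]]]]].
by case/andP=> -> /hasP[q qQ /allP uvwq]; split=> //; exists q.
Qed.

Lemma blowup_mono_core b m x y z :
    x <= core b * 5 ^ m -> y <= core b * 5 ^ m -> z <= core b * 5 ^ m ->
    x != y -> y != z -> z != x ->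
    blowup b m x y = blowup b m y z -> blowup b m y z = blowup b m z x ->
  core b * 5 ^ m \in [:: x; y; z] /\
  exists2 q, q \in core_triangles b & {subset [:: x; y; z] <= map (muln^~ (5 ^ m)) q}.
Proof.
move=> xb yb zb xy yz zx e1 e2.
have [r [u [v [w [ex ey ez [e3 e4]]]]]] := blowup_mono e1 e2.
have p_gt0 : 0 < 5 ^ m by rewrite expn_gt0.
have le a s : s = a * 5 ^ m + r -> s <= core b * 5 ^ m -> a <= core b.
  by move=> -> h; rewrite -(leq_pmul2r p_gt0); lia.
have [|||cuvw [q qQ uvwq]] := core_mono (le _ _ ex xb) (le _ _ ey yb) (le _ _ ez zb) _ _ _ e3 e4.
- by apply: contraNneq xy => uv; rewrite ex ey uv.
- by apply: contraNneq yz => vw; rewrite ey ez vw.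
- by apply: contraNneq zx => wu; rewrite ez ex wu.
(* One quotient equals [core b], while its vertex is at most [core b * 5 ^ m]. *)
have r0 : r = 0.
  by move: cuvw xb yb zb; rewrite !inE ex ey ez => /or3P[] /eqP ->; lia.
rewrite r0 !addn0 in ex ey ez; rewrite ex ey ez; split.
  by move: cuvw; rewrite !inE => /or3P[] /eqP ->; rewrite eqxx ?orbT.
exists q => // s; rewrite !inE => /or3P[] /eqP ->; apply: map_f; apply: uvwq;
  by rewrite !inE eqxx ?orbT.
Qed.

(** * Colourings of edges and of pairs *)

Section PairColor.
Variables (T : finType) (k : nat) (i0 : 'I_k) (c : coloring T k).
Implicit Types (x y z : T) (t : {set T}).

(* The diagonal gets the junk value [i0]. *)
Definition pair_color x y : 'I_k := oapp c i0 (insub [set x; y] : option (edge T)).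

Lemma pair_colorC x y : pair_color x y = pair_color y x.
Proof. by rewrite /pair_color setUC. Qed.

Lemma pair_color_edge (e : edge T) x y : val e = [set x; y] -> pair_color x y = c e.
Proof. by move=> E; rewrite /pair_color -E valK. Qed.

Lemma edge_of_pair x y : x != y -> exists e : edge T, val e = [set x; y].
Proof.
move=> xy; have E : #|[set x; y]| == 2 by rewrite cards2 xy.
by exists (Sub [set x; y] E); rewrite SubK.
Qed.

Lemma colors_on_triangle x y z : x != y -> y != z -> z != x ->
  colors_on c [set x; y; z] = [set pair_color x y; pair_color y z; pair_color z x].
Proof.
move=> xy yz zx; apply/setP=> a; apply/imsetP/idP => [[e]|]; last first.
  have sub u v : u \in [set x; y; z] -> v \in [set x; y; z] -> u != v ->
      exists2 e : edge T, e \in [set e : edge T | val e \subset [set x; y; z]]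
        & pair_color u v = c e.
    move=> ut vt /edge_of_pair[e E]; exists e; last exact: pair_color_edge.
    by rewrite inE E subUset !sub1set ut.
  by rewrite !inE -orbA => /or3P[] /eqP ->; apply: sub; rewrite // !inE eqxx ?orbT.
rewrite inE; have [u [v [uv E]]] : exists u v, u != v /\ val e = [set u; v].
  by apply/cards2P/(valP e).
rewrite E subUset !sub1set => /andP[ut vt] ->; rewrite -(pair_color_edge E).
move: ut vt uv; rewrite !inE -!orbA.
case/or3P=> /eqP->; case/or3P=> /eqP->; rewrite ?eqxx ?orbT // => _;
  by rewrite pair_colorC eqxx ?orbT.
Qed.

Lemma card_set3 (K : finType) (a b d : K) :
  #|[set a; b; d]| = (a \notin [set b; d]) + (b != d).+1.
Proof. by rewrite -setUA cardsU1 cards2. Qed.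

Lemma is_triangle_set3 x y z :
  x != y -> y != z -> z != x -> is_triangle [set x; y; z].
Proof.
by move=> xy yz zx; rewrite /is_triangle card_set3 !inE negb_or xy yz (eq_sym x) zx.
Qed.

Lemma triangle_set3 t : is_triangle t ->
  exists x y z, [/\ x != y, y != z, z != x & t = [set x; y; z]].
Proof.
move=> t3; have /card_gt2P[x [y [z [[xt yt zt] [xy yz zx]]]]] : 2 < #|t|.
  by rewrite (eqP t3).
exists x, y, z; split=> //; apply/esym/eqP.
rewrite eqEcard !subUset !sub1set xt yt zt /=.
by rewrite (eqP t3) (eqP (is_triangle_set3 xy yz zx)).
Qed.

(** Degenerate triples satisfy the condition by symmetry, whatever the diagonal value [i0], so the
    vertices need not be distinct. *)
Lemma gallai_pair_color :
  gallai c <-> forall x y z, [|| pair_color x y == pair_color y z,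
    pair_color y z == pair_color x z | pair_color x y == pair_color x z].
Proof.
have E x y z : (#|[set pair_color x y; pair_color y z; pair_color z x]| != 3)
    = [|| pair_color x y == pair_color y z,
    pair_color y z == pair_color x z | pair_color x y == pair_color x z].
  rewrite card_set3 !inE (pair_colorC z x).
  by case: (pair_color x y == pair_color y z); case: (pair_color x y == pair_color x z);
    case: (pair_color y z == pair_color x z).
split=> [/forallP gc x y z|gc].
  have [->|xy] := eqVneq x y; first by rewrite eqxx orbT.
  have [->|yz] := eqVneq y z; first by rewrite eqxx !orbT.
  have [->|zx] := eqVneq z x; first by rewrite pair_colorC eqxx.
  rewrite -E; have := gc [set x; y; z].
  by rewrite /rainbow_triangle is_triangle_set3 // colors_on_triangle.
apply/forallP=> t; apply/negP=> /andP[/triangle_set3[x [y [z [xy yz zx ->]]]]].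
by apply/negP; rewrite colors_on_triangle // E.
Qed.

Lemma mono_triangle_set3 x y z : x != y -> y != z -> z != x ->
  mono_triangle c [set x; y; z] = mono pair_color x y z.
Proof.
move=> xy yz zx.
rewrite /mono_triangle is_triangle_set3 // colors_on_triangle // card_set3 !inE.
rewrite /mono xy yz zx /=.
move: (pair_color x y) (pair_color y z) (pair_color z x) => a b d.
by case: (eqVneq b d) => [->|_]; [case: (a == d)|rewrite andbF; case: (_ || _)].
Qed.

Lemma mono_triangleP t :
  reflect (exists x y z, t = [set x; y; z] /\ mono pair_color x y z) (mono_triangle c t).
Proof.
apply: (iffP idP) => [tm|[x [y [z [-> m]]]]].
  have /andP[/triangle_set3[x [y [z [xy yz zx E]]]] _] := tm.
  by exists x, y, z; rewrite -mono_triangle_set3 // -E.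
by have /and5P[xy yz zx _ _] := m; rewrite mono_triangle_set3.
Qed.

Lemma num_mono_eq0 : (num_mono c == 0) = ~~ [exists t, mono_triangle c t].
Proof.
rewrite cards_eq0; apply/eqP/existsPn => [M0 t|noM].
  by have := in_set0 t; rewrite -M0 inE => ->.
by apply/setP=> t; rewrite !inE; apply: negPf (noM t).
Qed.

Lemma num_mono0_within : num_mono c = 0 -> mono_within pair_color setT set0.
Proof.
move/eqP; rewrite num_mono_eq0 => /existsPn noT x y z _ _ _ m.
case/negP: (noT [set x; y; z]); apply/mono_triangleP.
by exists x, y, z.
Qed.

Lemma num_mono1_within : num_mono c = 1 ->
  exists2 t : {set _}, #|t| = 3 & mono_within pair_color setT t.
Proof.
move/eqP/cards1P=> [t Mt].
have : t \in [set t | mono_triangle c t] by rewrite Mt set11.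
rewrite inE => /andP[/eqP t3 _]; exists t => // x y z _ _ _ m.
have : [set x; y; z] \in [set t | mono_triangle c t].
  by rewrite inE; apply/mono_triangleP; exists x, y, z.
by rewrite Mt inE => /eqP <-; rewrite !inE eqxx.
Qed.

End PairColor.

(** The ends of each edge are chosen in some order, which is immaterial as [g] is symmetric. *)
Lemma coloring_of_pairs (T : finType) k (i0 : 'I_k) (g : T -> T -> 'I_k) :
    (forall x y, g x y = g y x) ->
  exists c : coloring T k, forall x y, x != y -> pair_color i0 c x y = g x y.
Proof.
move=> gC.
have ends (e : edge T) : exists p : T * T, val e == [set p.1; p.2].
  by have /cards2P[x [y [_ E]]] := valP e; exists (x, y); apply/eqP.
exists [ffun e => g (xchoose (ends e)).1 (xchoose (ends e)).2] => x y xy.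
have [e E] := edge_of_pair xy; rewrite (pair_color_edge _ _ E) ffunE.
have := eqP (xchooseP (ends e)); move: (xchoose _) => [u v] /=; rewrite E => Exy.
have ux : u \in [set x; y] by rewrite Exy !inE eqxx.
have vx : v \in [set x; y] by rewrite Exy !inE eqxx orbT.
have xu : x \in [set u; v] by rewrite -Exy !inE eqxx.
have yu : y \in [set u; v] by rewrite -Exy !inE eqxx orbT.
move: ux vx xu yu; rewrite !inE.
case/orP=> /eqP->; case/orP=> /eqP-> //.
  by rewrite !orbb [y == x]eq_sym (negPf xy).
by rewrite !orbb (negPf xy).
Qed.

(** * The Gallai-Ramsey number and the minimum number of triangles *)

Lemma colored_byT (T : finType) k (g : T -> T -> 'I_k) : colored_by g setT setT.
Proof. by []. Qed.

Lemma forces_extremal k : 0 < k -> forces_mono k (extremal k).+1.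
Proof.
move=> k_gt0; apply/forallP=> c; apply/implyP=> gc; apply: contraT => noT.
pose i0 := Ordinal k_gt0.
have /eqP M0 : num_mono c == 0 by rewrite num_mono_eq0.
have := free_bound (@pair_colorC _ _ i0 c) ((gallai_pair_color i0 c).1 gc)
  (num_mono0_within (i0 := i0) M0) (@colored_byT _ _ _).
by rewrite !cardsT !card_ord ltnn.
Qed.

Lemma two_triangles k (c : coloring 'I_(extremal k).+1 k) :
  0 < k -> ~~ odd k -> gallai c -> num_mono c != 0 -> 1 < num_mono c.
Proof.
move=> k_gt0 evk gc M0; rewrite ltnNge; apply/negP=> M1.
pose i0 := Ordinal k_gt0.
have [t t3 tm] : exists2 t : {set _}, #|t| = 3 & mono_within (pair_color i0 c) setT t.
  by apply: num_mono1_within; apply/eqP; rewrite eqn_leq M1 lt0n.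
have := one_triangle_bound (@pair_colorC _ _ i0 c) ((gallai_pair_color i0 c).1 gc) _ _
  tm (@colored_byT _ _ _).
by rewrite t3 !cardsT !card_ord ltnn => /(_ evk isT).
Qed.

(** The number of digits with two colours of their own, once one colour (odd [k]) or two (even [k])
    are set aside for the core. *)
Definition depth k := k.-1./2.

Lemma depthE k : 0 < k -> (~~ odd k).+1 + (depth k).*2 = k.
Proof.
by case: k => // k _; rewrite /depth /= negbK addSn odd_double_half.
Qed.

Lemma extremalE k : 0 < k -> extremal k = core (odd k) * 5 ^ depth k.
Proof.
case: k => // k _; rewrite /extremal /depth /core /= uphalf_half.
by case: (odd k); rewrite /= ?add1n ?mul1n ?expnS.
Qed.

(** It serves twice: for [n <= extremal k] the conclusion [extremal k < n] rules out triangles, and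
    for one vertex more the triangles are confined to a short list. *)
Lemma blowup_coloring k n : 0 < k -> n <= (extremal k).+1 ->
  exists2 c : coloring 'I_n k, gallai c & forall t, mono_triangle c t ->
    extremal k < n /\ exists2 q, q \in core_triangles (odd k) &
      t \subset [set x : 'I_n | val x \in map (muln^~ (5 ^ depth k)) q].
Proof.
move=> k_gt0 n_le; set b := odd k; set m := depth k; pose i0 := Ordinal k_gt0.
have lt (x y : 'I_n) : blowup b m x y < k by have := blowup_lt b m x y; rewrite depthE.
have [|c cE] := @coloring_of_pairs 'I_n k i0 (fun x y => Ordinal (lt x y)).
  by move=> x y; apply: val_inj; rewrite /= blowupC.
have vE x y : x != y -> val (pair_color i0 c x y) = blowup b m x y by move=> /cE ->.
exists c.
  apply/(gallai_pair_color i0) => x y z.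
  have [->|xy] := eqVneq x y; first by rewrite eqxx orbT.
  have [->|yz] := eqVneq y z; first by rewrite eqxx !orbT.
  have [->|zx] := eqVneq z x; first by rewrite pair_colorC eqxx.
  have xz : x != z by rewrite eq_sym.
  by rewrite -!val_eqE !vE //; apply: blowup_gallai.
move=> t /(mono_triangleP i0)[x [y [z [-> /and5P[xy yz zx /eqP e1 /eqP e2]]]]].
have le (s : 'I_n) : s <= core b * 5 ^ m.
  by rewrite -extremalE // -ltnS; apply: leq_trans (ltn_ord s) n_le.
have [|| top [q qQ sub]] := blowup_mono_core (le x) (le y) (le z) xy yz zx.
- by rewrite -!vE // e1.
- by rewrite -!vE // e2.
split.
  by rewrite extremalE //; move: top; rewrite !inE => /or3P[] /eqP ->; apply: ltn_ord.
exists q => //; apply/subsetP=> s; rewrite !inE -orbA => sxyz; apply: sub.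
by rewrite !inE !val_eqE.
Qed.

Lemma gallai_ramsey3E k : 0 < k -> gallai_ramsey3 k = (extremal k).+1.
Proof.
move=> k_gt0; rewrite /gallai_ramsey3; case: ex_minnP => N fN minN.
apply/eqP; rewrite eqn_leq minN ?forces_extremal // ltnNge; apply/negP=> N_le.
have [c gc cm] := blowup_coloring k_gt0 (leqW N_le).
have /existsP[t /cm[]] := implyP (forallP fN c) gc.
by rewrite ltnNge N_le.
Qed.

Lemma card_val_in n (s : seq nat) : #|[set x : 'I_n | val x \in s]| <= size s.
Proof.
rewrite cardE -(size_map val); apply: uniq_leq_size.
  by rewrite (map_inj_uniq val_inj) enum_uniq.
by move=> a /mapP[x]; rewrite mem_enum inE => xs ->.
Qed.

Lemma min_mono_upper k : 0 < k ->
  min_mono k (extremal k).+1 <= size (core_triangles (odd k)).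
Proof.
move=> k_gt0; have [c gc cm] := blowup_coloring k_gt0 (leqnn _).
apply: leq_trans (min_mono_le gc) _; set Q := core_triangles _ in cm *.
pose tri q := [set x : 'I_(extremal k).+1 | val x \in map (muln^~ (5 ^ depth k)) q].
rewrite -(size_map tri); apply: leq_trans (card_size _).
apply/subset_leq_card/subsetP=> t; rewrite inE => tm.
have [_ [q qQ tq]] := cm t tm; have /andP[/eqP t3 _] := tm.
(* A triangle inside a set of at most three vertices equals it, so there are no more triangles than
   entries of [Q]. *)
apply/mapP; exists q => //; apply/eqP; rewrite eqEcard tq t3.
apply: leq_trans (card_val_in _ _) _; rewrite size_map.
by move: qQ; rewrite /Q /core_triangles; case: odd; rewrite !inE; [move/eqP->|case/orP=> /eqP->].
Qed.

Theorem theorem4p1 (k : nat) (k_gt0 : 0 < k) :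
  (odd k -> min_mono k (gallai_ramsey3 k) = 1) /\
  (~~ odd k -> min_mono k (gallai_ramsey3 k) = 2).
Proof.
rewrite gallai_ramsey3E //; have upper := min_mono_upper k_gt0.
have [c gc cmin] := min_mono_attained (extremal k).+1 k_gt0.
have M0 : num_mono c != 0.
  by rewrite num_mono_eq0 negbK (implyP (forallP (forces_extremal k_gt0) c)).
split=> [ok|ek]; apply/eqP; rewrite eqn_leq.
  by rewrite -{2}cmin lt0n M0 andbT; rewrite ok in upper.
by rewrite -{2}cmin two_triangles // andbT; rewrite (negPf ek) in upper.
Qed.
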